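(* Let $p$ be a prime and let $F$ be a pro-$p$ group which is a nontrivial free pro-$p$ product. Then $F$ can be cancelled from direct products of profinite groups: for all profinite groups $A,B$, if $F\times A\cong F\times B$ then $A\cong B$.
   Context: All homomorphisms and isomorphisms between profinite groups are continuous. The free pro-$p$ product $K_1\coprod_p K_2$ of pro-$p$ groups $K_1,K_2$ is their coproduct in the category of pro-$p$ groups: a pro-$p$ group with continuous homomorphisms from $K_1$ and $K_2$ such that any pair of continuous homomorphisms from $K_1$ and $K_2$ to a pro-$p$ group $L$ factors uniquely through a continuous homomorphism $K_1\coprod_p K_2\to L$. A pro-$p$ group $F$ is a nontrivial free pro-$p$ product if $F\cong K_1\coprod_p K_2$ for some nontrivial pro-$p$ groups $K_1,K_2$. *)

(* Defs.v *)
From HB Require Import structures.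
From mathcomp Require Import all_boot.
From mathcomp Require Import all_classical.
From mathcomp Require Import topology.

Set Implicit Arguments.
Unset Strict Implicit.
Unset Printing Implicit Defensive.

Local Open Scope classical_set_scope.
Local Open Scope group_scope.

HB.structure Definition PreTopologicalGroup := {G of Topological G & Group G}.

HB.mixin Record PreTopologicalGroup_isTopologicalGroup G
    of PreTopologicalGroup G := {
  mulg_continuous : continuous (fun x : G * G => x.1 * x.2) ;
  invg_continuous : continuous (fun x : G => x^-1)
}.

#[short(type="topologicalGroupType")]
HB.structure Definition TopologicalGroup :=
  {G of PreTopologicalGroup G & PreTopologicalGroup_isTopologicalGroup G}.

Section ProdTopologicalGroup.
Variables G H : topologicalGroupType.

Let prod_mulg_continuous :
  continuous (fun x : (G * H) * (G * H) => x.1 * x.2).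
Proof.
move=> [[x1 x2] [y1 y2]]; apply: cvg_pair => /=.
  apply: (cvg_comp (fun z : (G * H) * (G * H) => (z.1.1, z.2.1))
    (fun z : G * G => z.1 * z.2) _ (@mulg_continuous G (x1, y1))).
  apply: cvg_pair => /=.
    exact: (cvg_comp fst fst cvg_fst cvg_fst).
  exact: (cvg_comp snd fst cvg_snd cvg_fst).
apply: (cvg_comp (fun z : (G * H) * (G * H) => (z.1.2, z.2.2))
  (fun z : H * H => z.1 * z.2) _ (@mulg_continuous H (x2, y2))).
apply: cvg_pair => /=.
  exact: (cvg_comp fst snd cvg_fst cvg_snd).
exact: (cvg_comp snd snd cvg_snd cvg_snd).
Qed.

Let prod_invg_continuous : continuous (fun x : G * H => x^-1).
Proof.
move=> [x y]; apply: cvg_pair => /=.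
  exact: (cvg_comp fst (fun z : G => z^-1) cvg_fst (@invg_continuous G x)).
exact: (cvg_comp snd (fun z : H => z^-1) cvg_snd (@invg_continuous H y)).
Qed.

HB.instance Definition _ := PreTopologicalGroup_isTopologicalGroup.Build
  (G * H)%type prod_mulg_continuous prod_invg_continuous.

End ProdTopologicalGroup.

Definition continuous_hom (G H : topologicalGroupType) (f : G -> H) : Prop :=
  continuous f /\ monoid_morphism f.

Definition topgroup_iso (G H : topologicalGroupType) : Prop :=
  exists (f : G -> H) (g : H -> G),
    [/\ continuous_hom f, continuous_hom g, cancel f g & cancel g f].

Definition nontrivial (G : topologicalGroupType) : Prop := exists x : G, x != 1.

Definition profinite (G : topologicalGroupType) : Prop :=
  [/\ compact [set: G], hausdorff_space G & totally_disconnected [set: G]].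

Definition normal_subgroup (G : topologicalGroupType) (N : set G) : Prop :=
  [/\ N 1, forall x y, N x -> N y -> N (x * y), forall x, N x -> N x^-1
    & forall x y, N x -> N (x ^ y)].

Definition lcosets (G : topologicalGroupType) (N : set G) : set (set G) :=
  range (fun x : G => *%g x @` N).

(* For profinite [G] and open normal [N], the coset set [lcosets N] is the
   underlying set of the finite group [G / N]. *)
Definition pro_p (p : nat) (G : topologicalGroupType) : Prop :=
  profinite G /\
  forall N : set G, open N -> normal_subgroup N ->
    exists k : nat, (lcosets N #= `I_(p ^ k))%card.

Definition is_free_pro_p_product (p : nat) (K1 K2 P : topologicalGroupType)
    (i1 : K1 -> P) (i2 : K2 -> P) : Prop :=
  [/\ pro_p p P, continuous_hom i1, continuous_hom i2
    & forall L : topologicalGroupType, pro_p p L ->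
      forall (f1 : K1 -> L) (f2 : K2 -> L),
        continuous_hom f1 -> continuous_hom f2 ->
        exists! h : P -> L,
          [/\ continuous_hom h, h \o i1 = f1 & h \o i2 = f2]].

Definition nontrivial_free_pro_p_product (p : nat)
    (F : topologicalGroupType) : Prop :=
  exists K1 K2 P : topologicalGroupType,
    [/\ pro_p p K1, pro_p p K2, nontrivial K1, nontrivial K2
      & (exists (i1 : K1 -> P) (i2 : K2 -> P), is_free_pro_p_product p i1 i2)
        /\ topgroup_iso F P].

(* Main.v *)
Require Import Defs.
From HB Require Import structures.
From mathcomp Require Import all_boot.
From mathcomp Require Import all_algebra all_fingroup all_solvable.
From mathcomp Require Import all_classical.
From mathcomp Require Import topology.

(* Suppose that, whenever two commuting subgroups generate [F], one of them is
   trivial.  If [G = F * A = F' * B] with [F'] isomorphic to [F], apply this to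
   the projections of [F'] and [B] to [F], and to those of [F] and [A] to [F']:
   either [A = B], or [F' <= A] and [F <= B], and then
   [A = F' * (A :&: B)] is isomorphic to [F * (A :&: B) = B].

   Let [P] be the free pro-p product of [K1] and [K2], generated by commuting
   subgroups [X] and [Y].  Mapping [K1] and [K2] to the two generators of the
   Heisenberg group over [F_p] gives [a x * b y = a y * b x] for all characters
   [a] of [K1] and [b] of [K2].  By linear algebra, [X] and [Y] are not both
   killed by nontrivial characters of [P].  If no nontrivial character kills
   [X], then [X] surjects onto all finite quotients of [P], so [Y] is central.

   The centre of [P] is trivial: a derivation into the group algebra [F_p[M]]
   of a finite quotient [M] of [P] shows that the centralizer of [K1] has the
   same image in [M] as a subset of [K1], likewise for [K2], and no nontrivial
   element lies in both [K1] and [K2]. *)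

Set Implicit Arguments.
Unset Strict Implicit.
Unset Printing Implicit Defensive.

Import GRing.Theory.
Local Open Scope group_scope.

(** * Finite p-groups *)

(** The semidirect product of the group algebra [R[M]], written as functions on [M], by [M] acting
    through left translation. A map [g |-> (D g, f g)] into it is a homomorphism exactly when [f] is
    one and [D] is a derivation along [f]. *)
Definition wreath (R : finNzRingType) (M : finGroupType) : Type :=
  ({ffun M -> R} * M)%type.

Section Wreath.
Variables (R : finNzRingType) (M : finGroupType).
Local Notation W := (wreath R M).

HB.instance Definition _ := Finite.copy W ({ffun M -> R} * M)%type.

Definition wreath_mul (x y : W) : W :=
  ([ffun z => x.1 z + y.1 (x.2^-1 * z)%g]%R, x.2 * y.2).
Definition wreath_one : W := ([ffun=> 0%R], 1).
Definition wreath_inv (x : W) : W := ([ffun z => - x.1 (x.2 * z)%g]%R, x.2^-1).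

Fact wreath_mulA : associative wreath_mul.
Proof.
move=> [u g] [v h] [w k]; congr pair => /=; last by rewrite mulgA.
by apply/ffunP => z; rewrite !ffunE /= addrA invMg !mulgA.
Qed.

Fact wreath_mul1 : left_id wreath_one wreath_mul.
Proof.
move=> [u g]; congr pair => /=; last by rewrite mul1g.
by apply/ffunP => z; rewrite !ffunE invg1 mul1g add0r.
Qed.

Fact wreath_mulV : left_inverse wreath_one wreath_inv wreath_mul.
Proof.
move=> [u g]; congr pair => /=; last by rewrite mulVg.
by apply/ffunP => z; rewrite !ffunE /= invgK addNr.
Qed.

HB.instance Definition _ := Finite_isGroup.Build W
  wreath_mulA wreath_mul1 wreath_mulV.

Lemma wreath_mulE (x y : W) :
  x * y = ([ffun z => x.1 z + y.1 (x.2^-1 * z)%g]%R, x.2 * y.2).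
Proof. by []. Qed.

Lemma card_wreath : #|{: W}| = (#|R| ^ #|M| * #|M|)%N.
Proof. by rewrite card_prod card_ffun. Qed.

Definition wreath_base (m : M) : W := ([ffun=> 0%R], m).

Lemma wreath_baseM : {morph wreath_base : m n / m * n}.
Proof.
by move=> m n; rewrite wreath_mulE; congr pair; apply/ffunP => z;
  rewrite !ffunE addr0.
Qed.

(* A conjugate of [wreath_base], by the indicator function of [1]. *)
Definition wreath_twist (m : M) : W :=
  ([ffun z => (z == m)%:R - (z == 1%g)%:R]%R, m).

Lemma wreath_twistM : {morph wreath_twist : m n / m * n}.
Proof.
move=> m n; rewrite wreath_mulE; congr pair; apply/ffunP => z; rewrite !ffunE /=.
have -> : (m^-1 * z == n) = (z == m * n) by rewrite -(inj_eq (mulgI m)) mulKVg.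
have -> : (m^-1 * z == 1) = (z == m) by rewrite -(inj_eq (mulgI m)) mulKVg mulg1.
by rewrite [RHS]addrC addrA subrK.
Qed.

(** For a subgroup [H], this is right multiplication by the sum of the elements of [H] in the group
    algebra; it commutes with left translation, hence is an endomorphism. *)
Definition wreath_sum (H : {set M}) (x : W) : W :=
  ([ffun z => \sum_(t in H) x.1 (z * t)%g]%R, x.2).

Lemma wreath_sumM (H : {set M}) : {morph wreath_sum H : x y / x * y}.
Proof.
move=> x y; rewrite !wreath_mulE; congr pair; apply/ffunP => z; rewrite !ffunE /=.
by rewrite -big_split; apply: eq_bigr => t _; rewrite ffunE mulgA.
Qed.

Lemma wreath_sum_base (H : {set M}) m :
  wreath_sum H (wreath_base m) = wreath_base m.
Proof.
by congr pair; apply/ffunP => z; rewrite !ffunE big1 // => t _; rewrite ffunE.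
Qed.

Lemma wreath_sum_twist (H : {group M}) m z :
  (wreath_sum H (wreath_twist m)).1 z = ((z^-1 * m \in H)%g%:R - (z \in H)%:R)%R.
Proof.
rewrite ffunE (eq_bigr (fun t => (t == z^-1 * m)%g%:R - (t == z^-1)%g%:R)%R); last first.
  move=> t _; rewrite ffunE -(inj_eq (mulgI z^-1)) mulKg.
  by rewrite -[in X in (_ - X)%R](inj_eq (mulgI z^-1)) mulKg mulg1.
have sumE a : (\sum_(t in H) (t == a)%:R = (a \in H)%:R :> R)%R.
  case: (boolP (a \in H)) => aH; last first.
    by rewrite big1 // => t tH; case: eqP => // ta; rewrite -ta tH in aH.
  rewrite (bigD1 a) //= eqxx big1 ?addr0 // => t /andP[_ ta].
  by rewrite (negPf ta).
by rewrite sumrB !sumE groupV.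
Qed.

(** The elements [m] and [1] lie in the same left coset of [H], so summation over [H] kills
    [m - 1]. *)
Lemma wreath_sum_twist_in (H : {group M}) m :
  m \in H -> wreath_sum H (wreath_twist m) = wreath_base m.
Proof.
move=> mH; congr pair; apply/ffunP => z.
have /= := wreath_sum_twist H m z; rewrite ffunE => ->.
by rewrite ffunE groupMr // groupV subrr.
Qed.

End Wreath.

(** The triple [(a, b, c)] stands for the upper unitriangular 3 x 3 matrix with superdiagonal
    entries [a], [b] and corner entry [c]. *)
Definition heisenberg (R : finNzRingType) : Type := (R * R * R)%type.

Section Heisenberg.
Variable R : finNzRingType.
Local Notation U := (heisenberg R).

HB.instance Definition _ := Finite.copy U (R * R * R)%type.

Definition heisenberg_mul (x y : U) : U :=
  (x.1.1 + y.1.1, x.1.2 + y.1.2, x.2 + y.2 + x.1.1 * y.1.2)%R.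
Definition heisenberg_one : U := (0, 0, 0)%R.
Definition heisenberg_inv (x : U) : U :=
  (- x.1.1, - x.1.2, - x.2 + x.1.1 * x.1.2)%R.

Fact heisenberg_mulA : associative heisenberg_mul.
Proof.
move=> x y z; rewrite /heisenberg_mul /= mulrDl mulrDr !addrA.
by congr pair; rewrite [LHS](ACl (1*2*5*3*6*4))%AC.
Qed.

Fact heisenberg_mul1 : left_id heisenberg_one heisenberg_mul.
Proof. by case=> [[a b] c]; rewrite /heisenberg_mul /= mul0r !add0r addr0. Qed.

Fact heisenberg_mulV : left_inverse heisenberg_one heisenberg_inv heisenberg_mul.
Proof.
case=> [[a b] c]; rewrite /heisenberg_mul /= !addNr mulNr.
by rewrite addrAC addrK addNr.
Qed.

HB.instance Definition _ := Finite_isGroup.Build U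
  heisenberg_mulA heisenberg_mul1 heisenberg_mulV.

Lemma heisenberg_mulE (x y : U) :
  x * y = (x.1.1 + y.1.1, x.1.2 + y.1.2, x.2 + y.2 + x.1.1 * y.1.2)%R.
Proof. by []. Qed.

Lemma card_heisenberg : #|{: U}| = (#|R| * #|R| * #|R|)%N.
Proof. by rewrite !card_prod. Qed.

End Heisenberg.

(** A maximal subgroup containing [H] is normal of index [p], and the quotient by it is identified
    with the additive group of ['F_p]. *)
Lemma pgroup_character (p : nat) (p_prime : prime p) (M : finGroupType)
    (H : {group M}) :
  p.-group [set: M] -> H \proper [set: M] ->
  exists chi : M -> 'F_p, [/\ {morph chi : x y / (x * y)%g >-> (x + y)%R},
    forall x, x \in H -> chi x = 0%R & exists x, chi x <> 0%R].
Proof.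
move=> pM ltHM.
have [eqHM|[N maxN sHN]] := maximal_exists (proper_sub ltHM).
  by rewrite eqHM fintype.properxx in ltHM.
have nN := p_maximal_normal pM maxN.
have cardQ : #|[set: M] / N| = p.
  by rewrite card_quotient ?normal_norm // (p_maximal_index pM).
have : ([set: M] / N) \isog [set: 'F_p].
  rewrite isog_cyclic_card ?prime_cyclic ?cardQ ?cardsT ?card_Fp ?eqxx //.
case/isogP=> g injg img.
have inN x : x \in 'N(N) by apply: (fintype.subsetP (normal_norm nN)); rewrite inE.
have inQ x : coset N x \in [set: M] / N by rewrite mem_quotient ?inE.
exists (fun x => g (coset N x)); split=> [x y | x Hx |].
- by rewrite [coset _ _]morphM ?inN // morphM ?inQ.
- by rewrite coset_id ?(fintype.subsetP sHN) // morph1.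
have : (1%R : 'F_p) \in g @* ([set: M] / N) by rewrite img inE.
case/morphimP=> _ _ /morphimP[x _ _ ->] g1.
by exists x => /= gx0; move: g1; rewrite gx0 => /eqP; rewrite oner_eq0.
Qed.

(** * Finite quotients of pro-p groups *)

Local Open Scope classical_set_scope.

(** Otherwise the traces outside [O] of the clopen neighborhoods of [x] generate a proper filter. A
    cluster point of it lies in all these neighborhoods, which are closed, but not in [O], which is
    open. *)
Lemma clopen_bigcap_sub (T : topologicalType) (x : T) (O : set T) :
  compact [set: T] -> open O ->
  \bigcap_(U in [set U | clopen U /\ U x]) U `<=` O ->
  exists U, [/\ clopen U, U x & U `<=` O].
Proof.
move=> cT oO CO; apply: contrapT => noU.
pose D := [set U : set T | clopen U /\ U x].
pose F := filter_from D (fun U => U `\` O).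
have FF : ProperFilter F.
  apply: filter_from_proper; last first.
    move=> U [cU Ux]; apply: contrapT => UO.
    apply: noU; exists U; split=> // z Uz; apply: contrapT => nOz.
    by apply: UO; exists z.
  apply: filter_from_filter; first by exists setT; split => //; exact: clopenT.
  move=> U V [cU Ux] [cV Vx]; exists (U `&` V).
    by split; [exact: clopenI | split].
  by move=> z [[Uz Vz] nO].
have [z [_ Fz]] := cT F FF filterT.
have Cz : (\bigcap_(U in D) U) z.
  move=> U DU; have [[_ cU] _] := DU; rewrite (closure_id U).1 //.
  move=> V zV; have : F U by exists U => // ? [].
  by move=> /Fz/(_ zV).
have : F (~` O).
  by exists setT => [|? []//]; split=> //; exact: clopenT.
move=> /Fz; have zO : nbhs z O by apply: open_nbhs_nbhs; split=> //; exact: CO.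
by move=> /(_ _ zO)[y []].
Qed.

Lemma compact_totally_disconnected_zero_dimensional (T : topologicalType) :
  compact [set: T] -> hausdorff_space T -> totally_disconnected [set: T] ->
  zero_dimensional T.
Proof.
move=> cT hT tdT x y xy.
pose C := \bigcap_(U in [set U | clopen U /\ U x]) U.
have Cx : C x by move=> U [].
have clC : closed C by apply: closed_bigI => U [[]].
(* The quasi-component [C] of [x] is connected: normality separates the two
   parts of a clopen partition of [C], and by compactness the separation extends
   to a clopen neighborhood of [C]. *)
suff conC : connected C.
  have Cy : ~ C y.
    move=> Cy; have : connected_component [set: T] x y by exists C.
    by rewrite tdT // => yx; rewrite yx eqxx in xy.
  have oNy : open (~` [set y]).
    by apply: closed_openC; exact: accessible_closed_set1 (hausdorff_accessible hT) y.
  have CNy : C `<=` ~` [set y] by move=> z Cz zy; apply: Cy; rewrite -zy.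
  have [U [cU Ux UNy]] := clopen_bigcap_sub cT oNy CNy.
  by exists U; split=> // /UNy; apply.
move=> B [b Bb] [O1 oO1 BO1] [F1 cF1 BF1].
have clB : closed B by rewrite BF1; exact: closedI.
have clD : closed (C `&` ~` O1) by apply: closedI => //; exact: open_closedC.
have [V [oV BV VD]] : exists V : set T,
    [/\ open V, B `<=` V & closure V `<=` ~` (C `&` ~` O1)].
  have : set_nbhs B (~` (C `&` ~` O1)).
    apply/set_nbhsP; exists (~` (C `&` ~` O1)); split=> //.
      exact: closed_openC.
    by move=> z; rewrite BO1 => -[Cz Oz] [_ /(_ Oz)].
  case/(compact_normal hT cT clB) => V /set_nbhsP[W [oW BW WV]] clV.
  exists W; split=> //.
  exact: subset_trans (closureS WV) clV.
pose W := ~` closure V.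
have oW : open W by apply: closed_openC; exact: closed_closure.
have CVW : C `<=` V `|` W.
  move=> z Cz; have [Oz|nOz] := pselect (O1 z).
    by left; apply: BV; rewrite BO1.
  by right=> /VD; apply.
have [U [cU Ux UVW]] := clopen_bigcap_sub cT (openU oV oW) CVW.
have VW z : V z -> W z -> False by move=> /subset_closure Vz; apply.
have clUV : clopen (U `&` V).
  case: cU => oU cU; split; first exact: openI.
  suff -> : U `&` V = U `&` ~` W by apply: closedI => //; exact: open_closedC.
  apply/seteqP; split=> z [Uz Vz]; split=> //.
    by move=> /(VW _ Vz).
  by case: (UVW _ Uz).
have clUW : clopen (U `&` W).
  case: cU => oU cU; split; first exact: openI.
  suff -> : U `&` W = U `&` ~` V by apply: closedI => //; exact: open_closedC.
  apply/seteqP; split=> z [Uz Vz]; split=> //.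
    by move=> /VW/(_ Vz).
  by case: (UVW _ Uz).
apply/seteqP; split=> [z|z Cz]; first by rewrite BO1 => -[].
(* The side containing [x] meets [U] in a clopen neighborhood of [x], so all of [C] lies on that
   side; it must be [V], which contains [b]. *)
have [Vx|Wx] := UVW _ Ux.
  have [_ Vz] : (U `&` V) z by apply: Cz.
  rewrite BO1; split=> //; apply: contrapT => nOz.
  by have /VD := subset_closure Vz; apply.
have [_ Wb] : (U `&` W) b by apply: (_ : C b) => //; move: Bb; rewrite BO1 => -[].
by case: (VW b) => //; exact: BV.
Qed.

Lemma continuousM (T : topologicalType) (G : topologicalGroupType) (f g : T -> G) :
  continuous f -> continuous g -> continuous (fun x => f x * g x).
Proof.
move=> cf cg x; apply: (cvg_comp (fun z => (f z, g z)) (fun z : G * G => z.1 * z.2)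
  _ (@mulg_continuous G (f x, g x))).
exact: cvg_pair (cf x) (cg x).
Qed.

Lemma profinite_open_normal_separation (G : topologicalGroupType) (x : G) :
  profinite G -> x != 1 ->
  exists N : set G, [/\ open N, normal_subgroup N & ~ N x].
Proof.
move=> [cG hG tdG] x1.
have x1' : 1 != x by rewrite eq_sym.
have [U [[oU cU] U1 nUx]] :=
  compact_totally_disconnected_zero_dimensional cG hG tdG x1'.
(* Quantifying over both sides makes [N] normal; compactness of [G * G] makes
   it open. *)
pose N := [set g : G | forall ab : G * G, U (ab.1 * g * ab.2) <-> U (ab.1 * ab.2)].
exists N; split.
- rewrite openE => g Ng.
  have cGG : compact [set: G * G] by rewrite -setXTT; exact: compact_setX.
  pose P h (ab : G * G) := U (ab.1 * h * ab.2) <-> U (ab.1 * ab.2).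
  (* As [U] is clopen, membership of [a * h * b] and of [a * b] in [U] is locally constant;
     compactness then makes the neighborhood of [g] uniform in [(a, b)]. *)
  have nP ab : [set: G * G] ab -> \forall ab' \near ab & h \near g, P h ab'.
    move=> _.
    have c1 : continuous (fun z : (G * G) * G => z.1.1).
      by move=> [[a b] h]; exact: (cvg_comp fst fst cvg_fst cvg_fst).
    have c2 : continuous (fun z : (G * G) * G => z.1.2).
      by move=> [[a b] h]; exact: (cvg_comp fst snd cvg_fst cvg_snd).
    have c3 : continuous (fun z : (G * G) * G => z.2).
      by move=> [[a b] h]; exact: cvg_snd.
    have cl := continuousM (continuousM c1 c3) c2.
    have cr := continuousM c1 c2.
    have near_in (V : set G) : open V -> V (ab.1 * ab.2) -> V (ab.1 * g * ab.2) ->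
        nbhs (ab, g) [set z : (G * G) * G | V (z.1.1 * z.2 * z.1.2) /\ V (z.1.1 * z.1.2)].
      move=> oV V1 V2; apply: filterI.
        exact: (cl (ab, g) V (open_nbhs_nbhs (conj oV V2))).
      exact: (cr (ab, g) V (open_nbhs_nbhs (conj oV V1))).
    have [Uab|nUab] := pselect (U (ab.1 * ab.2)).
      have := near_in _ oU Uab ((Ng ab).2 Uab); apply: filterS => z [Uz1 Uz2].
      by split.
    have nUg : ~ U (ab.1 * g * ab.2) by move/(Ng ab).
    have := near_in _ (closed_openC cU) nUab nUg.
    by apply: filterS => z [Uz1 Uz2]; split.
  have NP := (compact_near_coveringP _).1 cGG G (nbhs g) P (nbhs_filter g) nP.
  by apply: filterS NP => h Ph ab; exact: Ph.
- split.
  + by move=> ab; rewrite mulg1.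
  + move=> g h Ng Nh ab; have := Nh (ab.1 * g, ab.2); have := Ng ab.
    by rewrite /= !mulgA => N1 N2; split=> [/N2/N1 | /N1/N2].
  + move=> g Ng ab; have := Ng (ab.1 * g^-1, ab.2).
    by rewrite /= mulgKV => -[N1 N2]; split=> [/N2 | /N1].
  + move=> g h Ng ab; have := Ng (ab.1 * h^-1, h * ab.2).
    by rewrite /= conjgE !mulgA mulgKV.
- move=> /(_ (1, 1)) /=; rewrite !mul1g mulg1 => -[_ Ux]; exact/nUx/Ux.
Qed.

Definition discrete_group (M : finGroupType) : Type := M.

Section DiscreteGroup.
Variable M : finGroupType.
Local Notation D := (discrete_group M).

HB.instance Definition _ := Group.copy D M.
HB.instance Definition _ := hasNbhs.Build D principal_filter.
HB.instance Definition _ := Discrete_ofNbhs.Build D erefl.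

Let discrete_mulg_continuous : continuous (fun x : D * D => x.1 * x.2).
Proof.
move=> [x y] U /= Uxy; have {}Uxy : U (x * y) by exact: nbhs_singleton.
exists ([set x], [set y]) => /=; first by split; exact: discrete_set1.
by move=> [a b] [/= -> ->].
Qed.

Let discrete_invg_continuous : continuous (fun x : D => x^-1).
Proof.
move=> x U /= Ux; have {}Ux : U x^-1 by exact: nbhs_singleton.
apply: (@filterS _ (nbhs x) _ [set x]) => [_ -> //|]; exact: discrete_set1.
Qed.

HB.instance Definition _ := PreTopologicalGroup_isTopologicalGroup.Build
  D discrete_mulg_continuous discrete_invg_continuous.

End DiscreteGroup.

Lemma discrete_group_pro_p (p : nat) (M : finGroupType) :
  p.-nat #|{: M}| -> pro_p p (discrete_group M).
Proof.
move=> pM; split; first split.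
- by apply: finite_compact; exact: (@finite_finset M).
- exact: discrete_hausdorff.
- exact/zero_dimension_totally_disconnected/discrete_zero_dimension.
move=> N _ [N1 NM NV _].
pose H0 : {set M} := [set x | `[< N x >]]%SET.
have inH x : x \in H0 <-> N x by rewrite inE; split=> /asboolP.
have gH : group_set H0.
  apply/group_setP; split; first exact/inH.
  by move=> x y /inH Nx /inH Ny; apply/inH/NM.
pose H := Group gH; pose L := lcosets H [set: M]%SET.
have [k cardL] : {k | #|L| = (p ^ k)%N}.
  apply: p_natP; apply: pnat_dvd pM.
  by rewrite card_lcosets -cardsT; exact: dvdn_indexg.
exists k; rewrite -cardL.
have -> : Defs.lcosets N =
    (fun i : 'I_#|L| => [set` (enum_val i : {set M})]) @` [set: 'I_#|L|].
  have cosetE x : [set` (x *: H)%g] = *%g x @` N.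
    apply/seteqP; split=> y /=.
      by case/lcosetP=> z /inH Nz ->; exists z.
    by case=> z Nz <-; apply/lcosetP; exists z => //; exact/inH.
  apply/seteqP; split=> [_ [x _ <-] | _ [i _ <-]].
    have Lx : (x *: H)%g \in L by apply/lcosetsP; exists x; rewrite ?inE.
    by exists (enum_rank_in Lx (x *: H)%g) => //; rewrite enum_rankK_in // cosetE.
  have /lcosetsP[x _ ->] := enum_valP i.
  by exists x => //; rewrite cosetE.
rewrite (card_eqr card_II).
apply: inj_card_eq => i j _ _ eqij; apply: enum_val_inj.
by apply/setP => z; have := congr1 (@^~ z) eqij => /= e; apply/idP/idP; rewrite e.
Qed.

(** The group law of [G / N] is transported to ['I_n] along the bijection between cosets and numbers
    below [n] that [pro_p] provides. *)
Lemma pro_p_finite_quotient (p : nat) (G : topologicalGroupType) (N : set G) :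
  prime p -> pro_p p G -> open N -> normal_subgroup N ->
  exists (M : finGroupType) (q : G -> discrete_group M),
    [/\ p.-nat #|{: M}|, continuous_hom q, forall m, exists x, q x = m
      & forall x, q x = 1 -> N x].
Proof.
move=> p_pr [_ pG] oN nN; have [k] := pG N oN nN.
set n := (p ^ k)%N => cardN.
have [N1 NM NV NJ] := nN.
have /card_set_bijP[c [fc ic sc]] := cardN.
pose C (x : G) : set G := *%g x @` N.
have CE x y : C x = C y <-> N (x^-1 * y).
  split=> [Cxy | Nxy].
    have : C y y by exists 1; rewrite ?mulg1.
    by rewrite -Cxy => -[z Nz <-]; rewrite mulKg.
  apply/seteqP; split=> _ [z Nz <-].
    exists ((x^-1 * y)^-1 * z); first by apply: NM => //; exact: NV.
    by rewrite invMg invgK -!mulgA mulKVg.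
  exists (x^-1 * y * z); first exact: NM.
  by rewrite -!mulgA mulKVg.
have NC x y : N (x * y) -> N (y * x).
  by move=> /(NJ _ x); rewrite conjgE !mulgA mulVg mul1g.
have LC x : Defs.lcosets N (C x) by exists x.
pose q0 x : 'I_n := Ordinal (fc _ (LC x)).
have q0E x y : q0 x = q0 y <-> N (x^-1 * y).
  rewrite -CE; split=> [[cxy] | Cxy]; last by apply: val_inj; rewrite /= Cxy.
  by apply: ic => //; rewrite inE; exact: LC.
have q0_surj i : exists x, q0 x = i.
  have [_ [x _ <-] ci] := sc _ (ltn_ord i).
  by exists x; apply: val_inj.
have [s sK] := choice q0_surj.
have q0M x y x' y' : q0 x = q0 x' -> q0 y = q0 y' -> q0 (x * y) = q0 (x' * y').
  move=> /q0E Nx /q0E Ny; apply/q0E; rewrite invMg -mulgA.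
  have -> : y^-1 * (x^-1 * (x' * y')) = (x^-1 * x') ^ y * (y^-1 * y').
    by rewrite conjgE !mulgA mulgK.
  by apply: NM => //; exact: NJ.
have q0V x x' : q0 x = q0 x' -> q0 x^-1 = q0 x'^-1.
  by move=> /q0E/NC/NV; rewrite invMg => Nx; apply/q0E.
pose mul i j := q0 (s i * s j).
pose inv i := q0 (s i)^-1.
have mulE x y : mul (q0 x) (q0 y) = q0 (x * y) by apply: q0M; rewrite sK.
have invE x : inv (q0 x) = q0 x^-1 by apply: q0V; rewrite sK.
have mulA : associative mul.
  by move=> i j k'; rewrite -(sK i) -(sK j) -(sK k') !mulE mulgA.
have mul1 : left_id (q0 1) mul by move=> i; rewrite -(sK i) mulE mul1g.
have mulV : left_inverse (q0 1) inv mul.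
  by move=> i; rewrite -(sK i) invE mulE mulVg.
pose M : finGroupType := HB.pack 'I_n (Finite_isGroup.Build 'I_n mulA mul1 mulV).
exists M, (q0 : G -> discrete_group M); split.
- by rewrite card_ord pnatX pnat_id ?orbT.
- split; last by split=> // x y; rewrite -mulE.
  move=> x U /= Ux.
  have {}Ux : U (q0 x) by exact: (@nbhs_singleton (discrete_group M) (q0 x) U).
  (* The map [q0] is constant on the coset of [x], which is open as the preimage of [N] under this
     translation. *)
  have cx : continuous (fun y : G => x^-1 * y).
    by apply: (@continuousM G G (fun=> x^-1) id) => y; [exact: cvg_cst | exact: cvg_id].
  have Nx : N (x^-1 * x) by rewrite mulVg.
  apply: (@filterS _ (nbhs x) _ _ _ _ (cx x N (open_nbhs_nbhs (conj oN Nx)))).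
  by move=> y /= /q0E <-.
- exact: q0_surj.
- by move=> x /esym /q0E; rewrite invg1 mul1g.
Qed.

Lemma continuous_discrete_groupP (T : topologicalType) (M : finGroupType)
    (f : T -> discrete_group M) :
  continuous f <-> forall x, \forall y \near x, f y = f x.
Proof.
split=> [cf x | fx x U /= Ux].
  exact: (cf x [set f x] (discrete_set1 (f x))).
have {}Ux : U (f x) by exact: nbhs_singleton.
by apply: (@filterS _ (nbhs x) _ _ _ _ (fx x)) => y /= ->.
Qed.

Lemma morph_continuous_hom (M N : finGroupType)
    (f : discrete_group M -> discrete_group N) :
  {morph f : x y / x * y} -> continuous_hom f.
Proof.
move=> fM; split; last first.
  by split=> //; apply: (mulgI (f 1)); rewrite -fM !mulg1.
apply/continuous_discrete_groupP => x.
by apply: (@filterS _ (nbhs x) _ _ _ _ (discrete_set1 x)) => y ->.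
Qed.

Lemma continuous_hom_comp (G H L : topologicalGroupType) (f : G -> H) (g : H -> L) :
  continuous_hom f -> continuous_hom g -> continuous_hom (g \o f).
Proof.
move=> [cf [f1 fM]] [cg [g1 gM]]; split.
  by move=> x; exact: (cvg_comp f g (cf x) (cg (f x))).
by split=> [|x y] /=; rewrite ?f1 ?fM.
Qed.

Lemma continuous_hom_trivial (G H : topologicalGroupType) :
  continuous_hom (fun _ : G => 1 : H).
Proof.
by split; [move=> x; exact: cvg_cst | split=> // x y; rewrite mulg1].
Qed.

Lemma continuous_hom_id (G : topologicalGroupType) : continuous_hom (@id G).
Proof. by split; [move=> x; exact: cvg_id | split]. Qed.

Lemma continuous_hom_pair (G : topologicalGroupType) (M N : finGroupType)
    (f : G -> discrete_group M) (g : G -> discrete_group N) :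
  continuous_hom f -> continuous_hom g ->
  continuous_hom (fun x => (f x, g x) : discrete_group (M * N)%type).
Proof.
move=> [/continuous_discrete_groupP cf [f1 fM]] [/continuous_discrete_groupP cg [g1 gM]].
split; last by split=> [|x y]; rewrite ?f1 ?g1 ?fM ?gM.
apply/continuous_discrete_groupP => x.
by apply: (@filterS2 _ (nbhs x) _ _ _ _ _ (cf x) (cg x)) => y -> ->.
Qed.

Lemma continuous_homV (G H : topologicalGroupType) (f : G -> H) x :
  continuous_hom f -> f x^-1 = (f x)^-1.
Proof.
by move=> [_ [f1 fM]]; apply: (mulgI (f x)); rewrite -fM !mulgV.
Qed.

Lemma profinite_open_normal_separation_seq (G : topologicalGroupType) (s : seq G) :
  profinite G -> 1 \notin s ->
  exists N : set G, [/\ open N, normal_subgroup N & {in s, forall x, ~ N x}].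
Proof.
move=> pG; elim: s => [_|x s IHs].
  by exists setT; split; [exact: openT | split | ].
rewrite inE negb_or => /andP[x1 /IHs[N [oN [N1 NM NV NJ] sN]]].
have x1' : x != 1 by rewrite eq_sym.
have [N' [oN' [N'1 N'M N'V N'J] xN']] := profinite_open_normal_separation pG x1'.
exists (N `&` N'); split; first exact: openI.
  split=> //.
  - by move=> y z [? ?] [? ?]; split; [exact: NM | exact: N'M].
  - by move=> y [? ?]; split; [exact: NV | exact: N'V].
  - by move=> y z [? ?]; split; [exact: NJ | exact: N'J].
move=> y; rewrite inE => /predU1P[-> [_ //]|ys [Ny _]]; exact: (sN y).
Qed.

(** A list is allowed because the computation of the centre needs several elements to stay
    nontrivial in one and the same quotient. *)
Lemma pro_p_residually_finite (p : nat) (G : topologicalGroupType) (s : seq G) :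
  prime p -> pro_p p G -> 1 \notin s ->
  exists (M : finGroupType) (q : G -> discrete_group M),
    [/\ p.-nat #|{: M}|, continuous_hom q, forall m, exists x, q x = m
      & {in s, forall x, q x <> 1}].
Proof.
move=> p_pr pG s1.
have [N [oN nN sN]] := profinite_open_normal_separation_seq pG.1 s1.
have [M [q [pM cq sq qN]]] := pro_p_finite_quotient p_pr pG oN nN.
by exists M, q; split=> // x xs /qN; exact: sN.
Qed.

(** The image of [X] in the finite group [M] is closed under products, hence a subgroup; it misses
    some [m], so it is proper and a nontrivial character kills it. The group law of
    [discrete_group 'F_p] is addition, so [chi x = 1] means that the value is zero. *)
Lemma pro_p_character (p : nat) (G : topologicalGroupType) (M : finGroupType)
    (q : G -> discrete_group M) (X : set G) :
  prime p -> p.-nat #|{: M}| -> continuous_hom q -> (forall m, exists x, q x = m) ->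
  X 1 -> (forall x y, X x -> X y -> X (x * y)) ->
  (exists m, forall x, X x -> q x <> m) ->
  exists chi : G -> discrete_group 'F_p,
    [/\ continuous_hom chi, forall x, X x -> chi x = 1 & exists x, chi x <> 1].
Proof.
move=> p_pr pM cq sq X1 XM [m Xm].
have [_ [q1 qM]] := cq.
pose H0 : {set M} := [set z | `[< exists2 x, X x & q x = z >]]%SET.
have gH : group_set H0.
  apply/group_setP; split; first by rewrite !inE; exists 1.
  move=> y z /[!inE] -[x Xx qx] [x' Xx' qx'].
  by exists (x * x'); [exact: XM | rewrite qM qx qx'].
have ltH : Group gH \proper [set: M]%SET.
  rewrite properT; apply/eqP => /setP/(_ m) /[!inE] /asboolP[x Xx qx].
  exact: Xm qx.
have pM' : p.-group [set: M]%SET by rewrite /pgroup cardsT.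
have [chi [chiM chiH [z chiz]]] := pgroup_character p_pr pM' ltH.
exists (chi \o q); split.
- by apply: continuous_hom_comp => //; exact: morph_continuous_hom.
- by move=> x Xx; apply: chiH; rewrite !inE; exists x.
- by have [x qx] := sq z; exists x; rewrite /= qx.
Qed.

(** * Free pro-p products *)

Section FreeProduct.
Variables (p : nat) (p_pr : prime p) (K1 K2 P : topologicalGroupType).
Variables (i1 : K1 -> P) (i2 : K2 -> P).
Hypothesis freeP : is_free_pro_p_product p i1 i2.

Lemma free_product_extend (L : topologicalGroupType) (f1 : K1 -> L) (f2 : K2 -> L) :
  pro_p p L -> continuous_hom f1 -> continuous_hom f2 ->
  exists h : P -> L, [/\ continuous_hom h, forall k, h (i1 k) = f1 k
    & forall k, h (i2 k) = f2 k].
Proof.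
case: freeP => _ _ _ /[apply] UP cf1 cf2.
have [h [[ch h1 h2] _]] := UP _ _ cf1 cf2.
by exists h; split=> // k; rewrite -?h1 -?h2.
Qed.

Lemma free_product_unique (L : topologicalGroupType) (g h : P -> L) :
  pro_p p L -> continuous_hom g -> continuous_hom h ->
  (forall k, g (i1 k) = h (i1 k)) -> (forall k, g (i2 k) = h (i2 k)) ->
  forall x, g x = h x.
Proof.
case: freeP => _ c1 c2 /[apply] UP cg ch e1 e2 x.
have [u [_ uu]] := UP _ _ (continuous_hom_comp c1 cg) (continuous_hom_comp c2 cg).
have <- := uu g (And3 cg erefl erefl).
by rewrite -(uu h) //; split=> //; apply/funext => k /=.
Qed.

Lemma discrete_group_Fp_pro_p : pro_p p (discrete_group 'F_p).
Proof. by apply: discrete_group_pro_p; rewrite card_Fp ?pnat_id. Qed.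

Lemma free_product_retract1 : pro_p p K1 ->
  exists r : P -> K1, [/\ continuous_hom r, cancel i1 r & forall k, r (i2 k) = 1].
Proof.
move=> pK1; have [r [cr r1 r2]] := free_product_extend pK1
  (continuous_hom_id K1) (continuous_hom_trivial K2 K1).
by exists r.
Qed.

Lemma free_product_retract2 : pro_p p K2 ->
  exists r : P -> K2, [/\ continuous_hom r, cancel i2 r & forall k, r (i1 k) = 1].
Proof.
move=> pK2; have [r [cr r1 r2]] := free_product_extend pK2
  (continuous_hom_trivial K1 K2) (continuous_hom_id K2).
by exists r.
Qed.

(* Send [K1] and [K2] to the two generators of the Heisenberg group over [F_p]. *)
Lemma free_product_character_commute (a b : P -> discrete_group 'F_p) (x y : P) :
  continuous_hom a -> continuous_hom b ->
  (forall k, a (i2 k) = 1) -> (forall k, b (i1 k) = 1) ->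
  x * y = y * x -> ((a x : 'F_p) * b y = (a y : 'F_p) * b x)%R.
Proof.
move=> ca cb a2 b1 xy; have [_ c1 c2 _] := freeP.
have pU : pro_p p (discrete_group (heisenberg 'F_p)).
  by apply: discrete_group_pro_p; rewrite card_heisenberg card_Fp // !pnatM !pnat_id.
pose e1 (t : discrete_group 'F_p) : discrete_group (heisenberg 'F_p) := (t, 0, 0)%R.
pose e2 (t : discrete_group 'F_p) : discrete_group (heisenberg 'F_p) := (0, t, 0)%R.
have ce1 : continuous_hom e1.
  apply: morph_continuous_hom => s t.
  by rewrite [RHS]heisenberg_mulE /e1 /= mulr0 !addr0.
have ce2 : continuous_hom e2.
  apply: morph_continuous_hom => s t.
  by rewrite [RHS]heisenberg_mulE /e2 /= mul0r !addr0.
have [h [ch h1 h2]] := free_product_extend pU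
  (continuous_hom_comp (continuous_hom_comp c1 ca) ce1)
  (continuous_hom_comp (continuous_hom_comp c2 cb) ce2).
pose p1 (u : discrete_group (heisenberg 'F_p)) : discrete_group 'F_p := u.1.1.
pose p2 (u : discrete_group (heisenberg 'F_p)) : discrete_group 'F_p := u.1.2.
have cp1 : continuous_hom p1 by apply: morph_continuous_hom.
have cp2 : continuous_hom p2 by apply: morph_continuous_hom.
(* The superdiagonal entries of [h] are homomorphisms agreeing with [a] and [b] on both factors. *)
have ha : forall z, (h z).1.1 = a z.
  apply: (free_product_unique discrete_group_Fp_pro_p
    (continuous_hom_comp ch cp1) ca) => k /=; first by rewrite h1.
  by rewrite h2 a2.
have hb : forall z, (h z).1.2 = b z.
  apply: (free_product_unique discrete_group_Fp_pro_p
    (continuous_hom_comp ch cp2) cb) => k /=; first by rewrite h1 b1.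
  by rewrite h2.
have [_ [_ hM]] := ch.
(* In the corner entries of [h x * h y] and [h y * h x] the sum of [(h x).2] and [(h y).2] cancels,
   leaving the products of superdiagonal entries. *)
have := congr1 h xy; rewrite !hM => /(congr1 snd) /=.
rewrite -!ha -!hb [((h x).2 + _)%R]addrC; exact: addrI.
Qed.

End FreeProduct.

Lemma is_free_pro_p_productC (p : nat) (K1 K2 P : topologicalGroupType)
    (i1 : K1 -> P) (i2 : K2 -> P) :
  is_free_pro_p_product p i1 i2 -> is_free_pro_p_product p i2 i1.
Proof.
case=> pP c1 c2 UP; split=> // L pL f2 f1 cf2 cf1.
have [h [[ch h1 h2] uh]] := UP L pL f1 f2 cf1 cf2.
by exists h; split=> [|g [cg g1 g2]]; [split | exact: uh].
Qed.

(* The homomorphism [h] extends [f] by a derivation [D] into the group algebra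
   [F_p[M]] that vanishes on [K1] and is [g |-> f g - 1] on [K2].  If [y]
   centralizes [K1], then [D y] is invariant under [H = f K1], so its sum over
   [H] is [#|H| * D y 1 = 0]; but that sum is [(f y \in H) - 1]. *)
Lemma free_product_centralizer (p : nat) (p_pr : prime p)
    (K1 K2 P : topologicalGroupType) (i1 : K1 -> P) (i2 : K2 -> P)
    (freeP : is_free_pro_p_product p i1 i2) (M : finGroupType)
    (f : P -> discrete_group M) (y : P) :
  p.-nat #|{: M}| -> continuous_hom f -> (forall k, y * i1 k = i1 k * y) ->
  (exists k, f (i1 k) <> 1) -> exists k, f (i1 k) = f y.
Proof.
move=> pM cf yC [k0 fk0].
have [_ c1 c2 _] := freeP.
have cf1 := continuous_hom_comp c1 cf; have cf2 := continuous_hom_comp c2 cf.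
have pW : pro_p p (discrete_group (wreath 'F_p M)).
  apply: discrete_group_pro_p.
  by rewrite card_wreath card_Fp // pnatM pnatX pnat_id // pM.
pose H0 : {set M} := [set z | `[< exists k, f (i1 k) = z >]]%SET.
have gH : group_set H0.
  apply/group_setP; split; first by rewrite !inE; exists 1; exact: cf1.2.1.
  move=> z z' /[!inE] -[k <-] [k' <-].
  by exists (k * k'); rewrite -[LHS]/((f \o i1) (k * k')) cf1.2.2.
pose H := Group gH.
have inH k : f (i1 k) \in H by rewrite !inE; exists k.
pose base : discrete_group M -> discrete_group (wreath 'F_p M) := @wreath_base _ M.
pose twist : discrete_group M -> discrete_group (wreath 'F_p M) := @wreath_twist _ M.
pose sumH : discrete_group (wreath 'F_p M) -> discrete_group (wreath 'F_p M) :=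
  @wreath_sum 'F_p M H.
have cbase : continuous_hom base by apply/morph_continuous_hom/wreath_baseM.
have ctwist : continuous_hom twist by apply/morph_continuous_hom/wreath_twistM.
have csum : continuous_hom sumH by apply/morph_continuous_hom/wreath_sumM.
have [h [ch h1 h2]] := free_product_extend freeP pW
  (continuous_hom_comp cf1 cbase) (continuous_hom_comp cf2 ctwist).
(* After summation over [H], the derivation becomes that of [g |-> f g - 1] on both factors: on [K1]
   both sums vanish, since [f] takes values in [H] there. *)
have sum_h : forall z, sumH (h z) = sumH (twist (f z)).
  apply: (free_product_unique freeP pW (continuous_hom_comp ch csum)
    (continuous_hom_comp (continuous_hom_comp cf ctwist) csum)) => k /=.
    by rewrite h1 /= /sumH wreath_sum_base [RHS]wreath_sum_twist_in.
  by rewrite h2.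
(* Since [D] vanishes on [K1], applying [h] to [y * i1 k = i1 k * y] shows that [D y] is fixed by
   translation by [f (i1 k)]; this is evaluated at [f (i1 k)]. *)
have hy_inv t : t \in H -> (h y).1 t = (h y).1 1.
  rewrite !inE => -[k <-].
  have := congr1 h (yC k); rewrite !ch.2.2 h1 => /(congr1 fst) /=.
  move=> /ffunP/(_ (f (i1 k))); rewrite !ffunE /= mulVg.
  by rewrite addr0 add0r.
have card_H : (#|H|%:R = 0 :> 'F_p)%R.
  have pH : p.-group H.
    by rewrite /pgroup (pnat_dvd _ pM) // -cardsT cardSg ?finset.subsetT.
  (* A nontrivial [p]-group has order divisible by [p]; for trivial [H] the order [1] would not
     vanish in ['F_p]. *)
  have ntH : H :!=: 1%g.
    by apply/trivgPn; exists (f (i1 k0)) => //; apply/eqP.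
  have [_ pdvd _] := pgroup_pdiv pH ntH.
  by apply/eqP; rewrite -(dvdn_pcharf (pchar_Fp p_pr)).
have sum0 : (\sum_(t in H) (h y).1 (1 * t)%g = 0)%R.
  rewrite (eq_bigr (fun=> (h y).1 1)) => [|t /hy_inv]; last by rewrite mul1g.
  by rewrite sumr_const -mulr_natl card_H mul0r.
have /(congr1 (fun w : wreath 'F_p M => w.1 1)) := sum_h y.
rewrite [RHS]wreath_sum_twist ffunE invg1 mul1g group1 [LHS]sum0.
have [|_] := boolP (f y \in H); first by rewrite !inE.
by move/esym/eqP; rewrite sub0r oppr_eq0 oner_eq0.
Qed.

Lemma free_product_center (p : nat) (p_pr : prime p)
    (K1 K2 P : topologicalGroupType) (i1 : K1 -> P) (i2 : K2 -> P) (y : P) :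
  pro_p p K1 -> pro_p p K2 -> nontrivial K1 -> nontrivial K2 ->
  is_free_pro_p_product p i1 i2 -> (forall x, y * x = x * y) -> y = 1.
Proof.
move=> pK1 pK2 [k1 k1n] [k2 k2n] freeP yC; apply: contrapT => /eqP yn.
have [pP c1 c2 _] := freeP.
have [r [cr r1 r2]] := free_product_retract1 freeP pK1.
have [r' [cr' r1' _]] := free_product_retract2 freeP pK2.
(* Keeping [y] nontrivial gives the final contradiction; keeping the other two makes [f] nontrivial
   on each factor, as [free_product_centralizer] requires. *)
have s1 : 1 \notin [:: y; i1 k1; i2 k2].
  rewrite !inE !negb_or eq_sym yn /=; apply/andP; split; apply/eqP => e.
    by move: k1n; rewrite -(r1 k1) -e cr.2.1 eqxx.
  by move: k2n; rewrite -(r1' k2) -e cr'.2.1 eqxx.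
have [M [f [pM cf _ fs]]] := pro_p_residually_finite p_pr pP s1.
(* The second coordinate [f (i1 (r _))] tells the factors apart: on [K1] both coordinates agree, on
   [K2] the second is [1]. The image of [y] comes from each factor, so [f y = 1]. *)
have cg := continuous_hom_pair cf
  (continuous_hom_comp cr (continuous_hom_comp c1 cf)).
have pMM : p.-nat #|{: M * M}| by rewrite card_prod pnatM pM.
have [k /esym [fy1 fy2]] : exists k, (f (i1 k), f (i1 (r (i1 k)))) =
    (f y, f (i1 (r y))) :> discrete_group (M * M)%type.
  apply: (free_product_centralizer p_pr freeP pMM cg) => //.
  by exists k1 => -[e _]; apply: (fs (i1 k1)) e; rewrite !inE eqxx ?orbT.
have [k' /esym [_]] : exists k, (f (i2 k), f (i1 (r (i2 k)))) =
    (f y, f (i1 (r y))) :> discrete_group (M * M)%type.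
  apply: (free_product_centralizer p_pr (is_free_pro_p_productC freeP) pMM cg) => //.
  by exists k2 => -[e _]; apply: (fs (i2 k2)) e; rewrite !inE eqxx ?orbT.
rewrite r2 c1.2.1 cf.2.1 fy2 r1 -fy1; apply: fs; rewrite !inE eqxx ?orTb //.
Qed.

Lemma pro_p_nontrivial_character (p : nat) (G : topologicalGroupType) :
  prime p -> pro_p p G -> nontrivial G ->
  exists chi : G -> discrete_group 'F_p, continuous_hom chi /\ exists x, chi x <> 1.
Proof.
move=> p_pr pG [x x1].
have s1 : 1 \notin [:: x] by rewrite inE eq_sym.
have [M [q [pM cq sq /(_ x)]]] := pro_p_residually_finite p_pr pG s1.
rewrite inE eqxx => /(_ isT) qx.
have [|||chi [cchi _ chi1]] := pro_p_character (X := [set 1]) p_pr pM cq sq.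
- by [].
- by move=> _ _ -> ->; rewrite mulg1.
- by exists (q x) => _ -> q1; apply: qx; rewrite -q1 cq.2.1.
by exists chi.
Qed.

(** Composing [chi] with the retractions onto the factors gives [a] and [b]. Their product is a
    homomorphism because ['F_p] is commutative, and it agrees with [chi] on both factors. *)
Lemma free_product_character_split (p : nat) (p_pr : prime p)
    (K1 K2 P : topologicalGroupType) (i1 : K1 -> P) (i2 : K2 -> P)
    (chi : P -> discrete_group 'F_p) :
  pro_p p K1 -> pro_p p K2 -> is_free_pro_p_product p i1 i2 -> continuous_hom chi ->
  exists a b : P -> discrete_group 'F_p, [/\ continuous_hom a, continuous_hom b,
    forall k, a (i2 k) = 1, forall k, b (i1 k) = 1 & forall x, chi x = a x * b x].
Proof.
move=> pK1 pK2 freeP cchi; have [_ c1 c2 _] := freeP.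
have [r [cr r1 r2]] := free_product_retract1 freeP pK1.
have [r' [cr' r1' r2']] := free_product_retract2 freeP pK2.
have ca := continuous_hom_comp cr (continuous_hom_comp c1 cchi).
have cb := continuous_hom_comp cr' (continuous_hom_comp c2 cchi).
have a2 k : chi (i1 (r (i2 k))) = 1 by rewrite r2 c1.2.1 cchi.2.1.
have b1 k : chi (i2 (r' (i1 k))) = 1 by rewrite r2' c2.2.1 cchi.2.1.
exists (chi \o (i1 \o r)), (chi \o (i2 \o r')); split=> // x.
pose m (u : discrete_group ('F_p * 'F_p)%type) : discrete_group 'F_p := u.1 * u.2.
have cm : continuous_hom m.
  by apply: morph_continuous_hom => -[s t] [s' t']; rewrite /m /=; exact: addrACA.
apply: (free_product_unique freeP (discrete_group_Fp_pro_p p_pr) cchi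
  (continuous_hom_comp (continuous_hom_pair ca cb) cm)) => k; rewrite /m /=.
  by rewrite b1 r1 mulg1.
by rewrite a2 r1' mul1g.
Qed.

Lemma free_product_commuting_factors (p : nat) (p_pr : prime p)
    (K1 K2 P : topologicalGroupType) (i1 : K1 -> P) (i2 : K2 -> P) (X Y : set P) :
  pro_p p K1 -> pro_p p K2 -> nontrivial K1 -> nontrivial K2 ->
  is_free_pro_p_product p i1 i2 ->
  X 1 -> (forall x y, X x -> X y -> X (x * y)) ->
  Y 1 -> (forall x y, Y x -> Y y -> Y (x * y)) ->
  (forall x y, X x -> Y y -> x * y = y * x) ->
  (forall z, exists x y, [/\ X x, Y y & z = x * y]) ->
  (forall x, X x -> x = 1) \/ (forall y, Y y -> y = 1).
Proof.
move=> pK1 pK2 nK1 nK2 freeP X1 XM Y1 YM XY PXY.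
have [pP c1 c2 _] := freeP.
(* If no nontrivial character kills [Z'], then [Z'] maps onto every finite quotient, so [z] commutes
   with every [g] there; by residual finiteness [z] is central. *)
have central_trivial (Z Z' : set P) : Z' 1 -> (forall x y, Z' x -> Z' y -> Z' (x * y)) ->
    (forall x y, Z x -> Z' y -> x * y = y * x) ->
    ~ (exists chi : P -> discrete_group 'F_p, [/\ continuous_hom chi,
        forall x, Z' x -> chi x = 1 & exists x, chi x <> 1]) ->
    forall z, Z z -> z = 1.
  move=> Z'1 Z'M ZZ' nochi z Zz.
  apply: (free_product_center p_pr pK1 pK2 nK1 nK2 freeP) => g.
  apply: contrapT => zg.
  have s1 : 1 \notin [:: z * g * (g * z)^-1].
    by rewrite inE eq_sym; apply/eqP => /divg1_eq.
  have [M [q [pM cq sq /(_ (z * g * (g * z)^-1))]]] := pro_p_residually_finite p_pr pP s1.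
  rewrite inE eqxx => /(_ isT); apply.
  have [z' Z'z' qz'] : exists2 z', Z' z' & q z' = q g.
    apply: contrapT => no; apply: nochi.
    apply: (pro_p_character p_pr pM cq sq Z'1 Z'M).
    by exists (q g) => x Z'x qx; apply: no; exists x.
  rewrite cq.2.2 (continuous_homV _ cq) !cq.2.2 -qz' -!cq.2.2 (ZZ' _ _ Zz Z'z').
  by rewrite mulgV.
pose kills (Z : set P) := exists chi : P -> discrete_group 'F_p,
  [/\ continuous_hom chi, forall x, Z x -> chi x = 1 & exists x, chi x <> 1].
suff [nX|nY] : ~ kills X \/ ~ kills Y.
- by right; exact: (central_trivial Y X X1 XM (fun y x Yy Xx => esym (XY x y Xx Yy)) nX).
- by left; exact: (central_trivial X Y Y1 YM XY nY).
apply: contrapT => /not_orP[/contrapT[chi [cchi chiX [z chiz]]]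
  /contrapT[psi [cpsi psiY [w psiw]]]].
have [a [b [ca cb a2 b1 chiE]]] := free_product_character_split p_pr pK1 pK2 freeP cchi.
have [a' [b' [ca' cb' a'2 b'1 psiE]]] :=
  free_product_character_split p_pr pK1 pK2 freeP cpsi.
have [r [cr r1 r2]] := free_product_retract1 freeP pK1.
have [r' [cr' r1' r2']] := free_product_retract2 freeP pK2.
(* The characters [c] and [d] come from the separate factors; one of them will be shown to vanish on
   [X] and on [Y], hence on [P]. *)
have [c [cc c_2 [u cu]]] : exists c : P -> discrete_group 'F_p,
    [/\ continuous_hom c, forall k, c (i2 k) = 1 & exists x, c x <> 1].
  have [t [ct [k tk]]] := pro_p_nontrivial_character p_pr pK1 nK1.
  exists (t \o r); split; first exact: continuous_hom_comp.
    by move=> k' /=; rewrite r2 ct.2.1.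
  by exists (i1 k); rewrite /= r1.
have [d [cd d_1 [v dv]]] : exists d : P -> discrete_group 'F_p,
    [/\ continuous_hom d, forall k, d (i1 k) = 1 & exists x, d x <> 1].
  have [t [ct [k tk]]] := pro_p_nontrivial_character p_pr pK2 nK2.
  exists (t \o r'); split; first exact: continuous_hom_comp.
    by move=> k' /=; rewrite r2' ct.2.1.
  by exists (i2 k); rewrite /= r1'.
have rel (e f : P -> discrete_group 'F_p) : continuous_hom e -> continuous_hom f ->
    (forall k, e (i2 k) = 1) -> (forall k, f (i1 k) = 1) ->
    forall x y, X x -> Y y -> ((e x : 'F_p) * f y = (e y : 'F_p) * f x)%R.
  move=> ce cf e2 f1 x y Xx Yy.
  by apply: (free_product_character_commute p_pr freeP ce cf e2 f1); exact: XY.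
have triv (e : P -> discrete_group 'F_p) z' : continuous_hom e ->
    (forall x, X x -> e x = 0%R) -> (forall y, Y y -> e y = 0%R) -> e z' = 0%R.
  move=> ce eX eY; have [x [y [Xx Yy ->]]] := PXY z'.
  rewrite ce.2.2 eX // eY //; exact: addr0.
have mul0 (s t : 'F_p) : (s * t = 0 -> s <> 0 -> t = 0)%R.
  by move=> /eqP; rewrite mulf_eq0 => /orP[/eqP -> //|/eqP].
(* As [psi] kills [Y] but not [P], it is nonzero somewhere on [X]; likewise [chi] somewhere on
   [Y]. *)
have [x0 [Xx0 psix0]] : exists x, X x /\ psi x <> 0%R.
  have [x [y [Xx Yy wE]]] := PXY w; exists x; split=> // psix; apply: psiw.
  by rewrite wE cpsi.2.2 psix (psiY y Yy); exact: addr0.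
have [y0 [Yy0 chiy0]] : exists y, Y y /\ chi y <> 0%R.
  have [x [y [Xx Yy zE]]] := PXY z; exists y; split=> // chiy; apply: chiz.
  by rewrite zE cchi.2.2 chiy (chiX x Xx); exact: addr0.
(* A homogeneous linear system in [s], [t] whose determinant is [s' + t'] up to sign. *)
have two (s t s' t' : 'F_p) :
    (s + t = 0 -> s' + t' <> 0 -> s * t' = s' * t -> s = 0 /\ t = 0)%R.
  move=> /addr0_eq <- st' /eqP.
  rewrite mulrN -addr_eq0 [(s' * s)%R]mulrC -mulrDr addrC mulrC => /eqP /mul0 -> //.
  by rewrite oppr0.
have abX x : X x -> (a x = 0 /\ b x = 0)%R.
  move=> Xx; apply: (two _ _ (a y0 : 'F_p) (b y0 : 'F_p)).
  - exact: etrans (esym (chiE x)) (chiX x Xx).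
  - by move=> ab0; apply: chiy0; rewrite chiE.
  - exact: rel.
have abY y : Y y -> (a' y = 0 /\ b' y = 0)%R.
  move=> Yy; apply: (two _ _ (a' x0 : 'F_p) (b' x0 : 'F_p)).
  - exact: etrans (esym (psiE y)) (psiY y Yy).
  - by move=> ab0; apply: psix0; rewrite psiE.
  - exact/esym/rel.
(* If [a y0 = 0], then [b y0] and [b' x0] are nonzero, and [rel] for [c] with [b] and with [b']
   forces [c] to vanish on [X] and [Y]. Otherwise [a y0] and [a' x0] are nonzero and the same
   happens to [d]. *)
have [ay0|/eqP ay0] := eqVneq (a y0 : 'F_p) 0%R.
  have by0 : (b y0 : 'F_p) <> 0%R.
    by move=> e; apply: chiy0; rewrite chiE ay0 e; exact: addr0.
  have cX x : X x -> c x = 0%R.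
    move=> Xx; apply: (mul0 (b y0) (c x)) => //.
    by rewrite mulrC rel // (abX x Xx).2 mulr0.
  have a'x0 : (a' x0 : 'F_p) = 0%R.
    apply: (mul0 (b y0) (a' x0)) => //.
    by rewrite mulrC rel // (abX x0 Xx0).2 mulr0.
  have b'x0 : (b' x0 : 'F_p) <> 0%R.
    by move=> e; apply: psix0; rewrite psiE a'x0 e; exact: addr0.
  apply: cu; apply: (triv c u cc cX) => y Yy.
  apply: (mul0 (b' x0) (c y)) => //.
  by rewrite mulrC -rel // (abY y Yy).2 mulr0.
have dX x : X x -> d x = 0%R.
  move=> Xx; apply: (mul0 (a y0) (d x)) => //.
  by rewrite -rel // (abX x Xx).1 mul0r.
have b'x0 : (b' x0 : 'F_p) = 0%R.
  apply: (mul0 (a y0) (b' x0)) => //.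
  by rewrite -rel // (abX x0 Xx0).1 mul0r.
have a'x0 : (a' x0 : 'F_p) <> 0%R.
  by move=> e; apply: psix0; rewrite psiE b'x0 e; exact: addr0.
apply: dv; apply: (triv d v cd dX) => y Yy.
apply: (mul0 (a' x0) (d y)) => //.
by rewrite rel // (abY y Yy).1 mul0r.
Qed.

(** * Cancellation *)

Lemma nontrivial_free_pro_p_product_nontrivial (p : nat) (F : topologicalGroupType) :
  nontrivial_free_pro_p_product p F -> nontrivial F.
Proof.
move=> [K1 [K2 [P [pK1 pK2 [k k1] _ [[i1 [i2 freeP]] [f [g [cf cg fK gK]]]]]]]].
have [r [cr r1 _]] := free_product_retract1 freeP pK1.
exists (g (i1 k)); apply: contra k1 => /eqP e.
by rewrite -(r1 k) -(gK (i1 k)) e cf.2.1 cr.2.1.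
Qed.

(** Transported to [P], the images of [u] and [v] are commuting subgroups with product [P].
    Homomorphisms are used in place of subgroups because the application is to projections. *)
Lemma nontrivial_free_pro_p_product_commuting (p : nat) (p_pr : prime p)
    (F G H : topologicalGroupType) (u : G -> F) (v : H -> F) :
  nontrivial_free_pro_p_product p F -> continuous_hom u -> continuous_hom v ->
  (forall x y, u x * v y = v y * u x) -> (forall z, exists x y, z = u x * v y) ->
  (forall x, u x = 1) \/ (forall y, v y = 1).
Proof.
move=> [K1 [K2 [P [pK1 pK2 nK1 nK2 [[i1 [i2 freeP]] [f [g [cf cg fK gK]]]]]]]].
move=> cu cv uv Fuv.
have cfu := continuous_hom_comp cu cf; have cfv := continuous_hom_comp cv cf.
have f_eq1 x : f x = 1 -> x = 1 by move=> e; rewrite -(fK x) e cg.2.1.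
have rangeM (L : topologicalGroupType) (w : L -> P) : continuous_hom w ->
    range w 1 /\ forall x y, range w x -> range w y -> range w (x * y).
  move=> [_ [w1 wM]]; split; first by exists 1.
  by move=> _ _ [x _ <-] [y _ <-]; exists (x * y).
have [X1 XM] := rangeM _ _ cfu; have [Y1 YM] := rangeM _ _ cfv.
have [||eX|eY] := free_product_commuting_factors p_pr pK1 pK2 nK1 nK2 freeP X1 XM Y1 YM.
- by move=> _ _ [x _ <-] [y _ <-] /=; rewrite -!cf.2.2 uv.
- move=> z; have [x [y e]] := Fuv (g z).
  exists (f (u x)), (f (v y)); split; [by exists x | by exists y |].
  by rewrite -cf.2.2 -e gK.
- by left=> x; apply: f_eq1; apply: eX; exists x.
- by right=> y; apply: f_eq1; apply: eY; exists y.
Qed.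

Section Cancellation.
Variables F A B : topologicalGroupType.

Lemma continuous_hom_fst : continuous_hom (fst : F * A -> F).
Proof. by split; [move=> [x a]; exact: cvg_fst | split]. Qed.

Lemma continuous_hom_snd : continuous_hom (snd : F * A -> A).
Proof. by split; [move=> [x a]; exact: cvg_snd | split]. Qed.

Lemma continuous_hom_inl : continuous_hom (fun x : F => (x, 1) : F * A).
Proof.
split; last by split=> // x y; congr pair; rewrite mulg1.
by move=> x; exact: cvg_pair cvg_id (cvg_cst _).
Qed.

Lemma continuous_hom_inr : continuous_hom (fun a : A => (1, a) : F * A).
Proof.
split; last by split=> // x y; congr pair; rewrite mulg1.
by move=> x; exact: cvg_pair (cvg_cst _) cvg_id.
Qed.

End Cancellation.

(** One formula for both cases of the cancellation. With [s] the [F]-component of [phi (1, a)],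
    either [s] is always [1], or [phi] sends [F] into [B]; in both cases [phi (s, a)] has
    [F]-component [s] again, and its [B]-component is the value. *)
Definition cancel_map (F A B : topologicalGroupType) (phi : F * A -> F * B) (a : A) : B :=
  (phi ((phi (1, a)).1, a)).2.

Lemma continuous_cancel_map (F A B : topologicalGroupType) (phi : F * A -> F * B) :
  continuous phi -> continuous (cancel_map phi).
Proof.
move=> cphi a.
have cs : continuous (fun a : A => phi (1, a)).
  by move=> b; exact: (cvg_comp _ phi ((continuous_hom_inr F A).1 b) (cphi (1, b))).
have cs1 : continuous (fun a : A => ((phi (1, a)).1, a)).
  move=> b; apply: cvg_pair cvg_id.
  exact: (cvg_comp _ fst (cs b) ((continuous_hom_fst F B).1 (phi (1, b)))).
have c2 : continuous (fun a : A => phi ((phi (1, a)).1, a)).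
  by move=> b; exact: (cvg_comp _ phi (cs1 b) (cphi _)).
exact: (cvg_comp _ snd (c2 a) ((continuous_hom_snd F B).1 _)).
Qed.

Lemma continuous_hom_cancel_map (F A B : topologicalGroupType) (phi : F * A -> F * B) :
  continuous_hom phi -> continuous_hom (cancel_map phi).
Proof.
move=> [cphi [phi1 phiM]]; split; first exact: continuous_cancel_map.
have pairM (a b : A) : (1 : F, a * b) = (1, a) * (1, b).
  by congr pair; rewrite mulg1.
split=> [|a b]; rewrite /cancel_map; first by rewrite !phi1.
rewrite pairM phiM.
by have := congr1 snd (phiM ((phi (1, a)).1, a) ((phi (1, b)).1, b)).
Qed.

(** Put [b = cancel_map phi a]. Then [phi (s, a) = (s, b)], and [s] is also the [F]-component of
    [psi (1, b)], so the formula for [psi] at [b] evaluates [psi (s, b) = (s, a)]. *)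
Lemma cancel_mapK (F A B : topologicalGroupType)
    (phi : F * A -> F * B) (psi : F * B -> F * A) :
  continuous_hom phi -> continuous_hom psi -> cancel phi psi ->
  (forall a, (phi (1, a)).1 = 1) /\ (forall b, (psi (1, b)).1 = 1) \/
  (forall x, (phi (x, 1)).1 = 1) /\ (forall x, (psi (x, 1)).1 = 1) ->
  cancel (cancel_map phi) (cancel_map psi).
Proof.
move=> [_ [_ phiM]] [_ [_ psiM]] phiK triv a.
have split_pair (C : topologicalGroupType) (x : F) (c : C) : (x, c) = (x, 1) * (1, c).
  by congr pair; rewrite ?mul1g ?mulg1.
pose s := (phi (1, a)).1.
have phi_s : phi (s, a) = (s, cancel_map phi a).
  rewrite [LHS]surjective_pairing; congr pair.
  case: triv => -[phi1 _]; first by rewrite /s phi1 phi1.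
  by rewrite split_pair phiM /= phi1 mul1g.
have psi_s : psi (s, cancel_map phi a) = (s, a) by rewrite -phi_s phiK.
have psi_1 : (psi (1, cancel_map phi a)).1 = s.
  case: triv => -[phi1 psi1]; first by rewrite psi1 /s phi1.
  have := congr1 fst psi_s; rewrite split_pair psiM /= psi1 mul1g => -> //.
by rewrite {1}/cancel_map psi_1 psi_s.
Qed.

Theorem theorem22 (p : nat) (p_prime : prime p) (F : topologicalGroupType)
    (F_pro_p : pro_p p F) (F_free : nontrivial_free_pro_p_product p F)
    (A B : topologicalGroupType) (A_profinite : profinite A)
    (B_profinite : profinite B) :
  topgroup_iso (F * A)%type (F * B)%type -> topgroup_iso A B.
Proof.
move=> [phi [psi [cphi cpsi phiK psiK]]].
have [x0 /eqP x0_neq1] := nontrivial_free_pro_p_product_nontrivial F_free.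
(* The images of [F] and [C] under [f] commute, and so do their projections to [F], whose product is
   all of [F] because [f] is onto. *)
have dichotomy (C D : topologicalGroupType) (f : F * C -> F * D) (g : F * D -> F * C) :
    continuous_hom f -> cancel g f ->
    (forall x, (f (x, 1)).1 = 1) \/ (forall c, (f (1, c)).1 = 1).
  move=> cf gK.
  have cf1 := continuous_hom_comp cf (continuous_hom_fst F D).
  apply: (nontrivial_free_pro_p_product_commuting p_prime F_free
    (continuous_hom_comp (continuous_hom_inl F C) cf1)
    (continuous_hom_comp (continuous_hom_inr F C) cf1)) => [x c | z] /=.
    rewrite -[LHS]/(_ * _).1 -[RHS]/(_ * _).1 -!cf.2.2.
    by congr (f _).1; congr pair; rewrite ?mul1g ?mulg1.
  exists (g (z, 1)).1, (g (z, 1)).2; rewrite -[RHS]/(_ * _).1 -cf.2.2.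
  have -> : ((g (z, 1)).1, 1) * (1, (g (z, 1)).2) = g (z, 1).
    by rewrite [RHS]surjective_pairing; congr pair; rewrite ?mul1g ?mulg1.
  by rewrite gK.
(* Here [g] would send [(x0, 1)] into [C], and [f] would send it back to an element with trivial
   [F]-component, although [x0] is not [1]. *)
have mixed (C D : topologicalGroupType) (f : F * C -> F * D) (g : F * D -> F * C) :
    cancel g f -> (forall c, (f (1, c)).1 = 1) -> (forall x, (g (x, 1)).1 = 1) -> False.
  move=> gK f1 g1; apply: x0_neq1; rewrite -[x0]/(x0, 1 : D).1 -(gK (x0, 1)).
  by rewrite [g _]surjective_pairing g1 f1.
suff triv : (forall a, (phi (1, a)).1 = 1) /\ (forall b, (psi (1, b)).1 = 1) \/
    (forall x, (phi (x, 1)).1 = 1) /\ (forall x, (psi (x, 1)).1 = 1).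
  exists (cancel_map phi), (cancel_map psi).
  split; [exact: continuous_hom_cancel_map.. | exact: cancel_mapK |].
  by apply: cancel_mapK => //; case: triv => -[? ?]; [left | right].
have [phi1|phi1] := dichotomy _ _ phi psi cphi psiK;
  have [psi1|psi1] := dichotomy _ _ psi phi cpsi phiK; [by right | | | by left].
- by case: (mixed _ _ psi phi phiK psi1 phi1).
- by case: (mixed _ _ phi psi psiK phi1 psi1).
Qed.
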